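(* Let $g\ge1$, $p\ge2$, and let $M_{g,p}=(\Sigma_g\times S^2)\setminus\operatorname{int}\nu F_{g,p}(u)$ be the complement of the cyclic degree-$p$ multisection. There is a split exact sequence $$1\longrightarrow\pi_1(P_p)\longrightarrow\pi_1(M_{g,p})\longrightarrow\pi_1(\Sigma_g)\longrightarrow1,$$ and $$\pi_1(M_{g,p})\cong\pi_1(P_p)\rtimes\pi_1(\Sigma_g),$$ where $a_1$ acts by $r_*$ and all the other standard base generators $b_1,a_2,b_2,\dots,a_g,b_g$ act trivially on $\pi_1(P_p)$.
   Context: $\Sigma_g$ is the closed connected oriented surface of genus $g$; $S^1_{\mathrm{eq}}\subset S^2$ is a fixed equator identified with the unit complex numbers; $N\in S^2$ is the north pole. For a smooth $u:\Sigma_g\to S^1$ representing a primitive class in $H^1(\Sigma_g;\mathbb Z)$, $$F_{g,p}(u)=\{(x,z)\in\Sigma_g\times S^1_{\mathrm{eq}}: z^p=u(x)\}\subset\Sigma_g\times S^2.$$ The tubular neighborhood $\nu F_{g,p}(u)$ is chosen fiberwise, meeting each sphere fiber $\{x\}\times S^2$ in $p$ small disks around the points of the multisection, so that $M_{g,p}\to\Sigma_g$ is a bundle with fiber $P_p=S^2\setminus\bigcup_{j=1}^p\operatorname{int}D_j$, the sphere with $p$ open disks (centered at $p$ equally spaced equatorial points) removed. Standard generators $$\pi_1(\Sigma_g)=\Bigl\langle a_1,b_1,\ldots,a_g,b_g\ \Big|\ \prod_{i=1}^g[a_i,b_i]=1\Bigr\rangle$$ are chosen so that $u_*(a_1)=1$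 and $u_*(b_1)=u_*(a_i)=u_*(b_i)=0$ for $i\ge2$. The map $r:P_p\to P_p$ is the rotation about the polar axis through angle $2\pi/p$, which cyclically permutes the $p$ boundary components and fixes $N$ (taken as the basepoint of $P_p$). *)

(* Defs.v *)
From HB Require Import structures.
From mathcomp Require Import all_boot all_order all_algebra generic_quotient.
From mathcomp Require Import all_classical all_reals all_analysis.
From mathcomp Require Import homotopy complex.
From mathcomp Require Import ring lra.

Set Implicit Arguments.
Unset Strict Implicit.
Unset Printing Implicit Defensive.

Import Order.TTheory GRing.Theory Num.Theory.
Import numFieldNormedType.Exports.

Local Open Scope classical_set_scope.
Local Open Scope ring_scope.

Section unit_interval.
Variable R : realType.

Definition unit_interval : Type := set_type `[0 : R, 1].

HB.instance Definition _ :=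
  Topological.copy unit_interval (set_type `[0 : R, 1]).

Lemma clamp_subproof (t : R) : Num.max 0 (Num.min 1 t) \in `[0 : R, 1]%classic.
Proof. by rewrite inE /= in_itv /= le_max lexx /= ge_max ler01 ge_min lexx. Qed.

Definition clamp (t : R) : unit_interval := SigSub (clamp_subproof t).

Definition itv0 := clamp 0.
Definition itv1 := clamp 1.

Lemma clampE (t : R) : 0 <= t <= 1 -> set_val (clamp t) = t.
Proof.
case/andP=> t0 t1; rewrite set_valE /= (min_idPr t1); exact/max_idPr.
Qed.

Lemma itv_bounds (t : unit_interval) : 0 <= set_val t <= 1.
Proof.
by case: t => t /= ht; move: (set_mem ht); rewrite set_valE /= in_itv.
Qed.

Lemma clampK (t : unit_interval) : clamp (set_val t) = t.
Proof. by apply: val_inj; rewrite -set_valE clampE// itv_bounds. Qed.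

Lemma itv_neq : itv0 != itv1.
Proof.
apply/eqP => /(congr1 set_val).
by rewrite !clampE ?lexx ?ler01// => /eqP; rewrite eq_sym oner_eq0.
Qed.

HB.instance Definition _ := isBiPointed.Build unit_interval itv_neq.

Lemma set_val_continuous : continuous (set_val : unit_interval -> R).
Proof. exact: initial_continuous. Qed.

Lemma clamp_continuous : continuous clamp.
Proof.
apply: (@continuous_comp_initial _ _ _ (set_val : unit_interval -> R)).
move=> t; apply: (@continuous_max R R (cst 0) (Num.min 1 : R -> R)).
  exact: cst_continuous.
apply: (@continuous_min R R (cst 1) id); first exact: cst_continuous.
by move=> ?; exact: cvg_id.
Qed.

End unit_interval.

Lemma continuous_if_le (R : realType) (Z X : topologicalType) (h : Z -> R)
    (f g : Z -> X) (c : R) :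
  continuous h -> continuous f -> continuous g ->
  (forall z, h z = c -> f z = g z) ->
  continuous (fun z => if h z <= c then f z else g z).
Proof.
move=> hc fc gc fg; apply/continuous_subspace_setT.
have -> : [set: Z] = (h @^-1` [set x | x <= c]) `|` (h @^-1` [set x | x >= c]).
  by apply/seteqP; split=> // z _ /=; apply/orP; exact: le_total.
have cl1 : closed (h @^-1` [set x | x <= c]).
  by move/continuous_closedP: hc; apply; exact: closed_le.
have cl2 : closed (h @^-1` [set x | x >= c]).
  by move/continuous_closedP: hc; apply; exact: closed_ge.
apply: withinU_continuous => //.
  apply: (@subspace_eq_continuous _ _ _ f); last exact: continuous_subspaceT.
  move=> z /set_mem /= hz. 
  by rewrite /from_subspace /= ifT.
apply: (@subspace_eq_continuous _ _ _ g); last exact: continuous_subspaceT.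
move=> z /set_mem /= cz; rewrite /from_subspace /=; case: ifP => // zc.
by rewrite fg//; apply/eqP; rewrite eq_le zc cz.
Qed.

Section continuity_helpers.
Context {R : realType} {T : topologicalType}.

Lemma cont_id : continuous (fun x : T => x).
Proof. by move=> x; exact: cvg_id. Qed.

Lemma cont_pair (U V : topologicalType) (f : T -> U) (g : T -> V) :
  continuous f -> continuous g -> continuous (fun x => (f x, g x)).
Proof. by move=> fc gc x; apply: cvg_pair => /=; [exact: fc|exact: gc]. Qed.

Lemma cont_comp (U V : topologicalType) (f : T -> U) (g : U -> V) :
  continuous g -> continuous f -> continuous (fun x => g (f x)).
Proof. by move=> gc fc x; apply: continuous_comp; [exact: fc|exact: gc]. Qed.

Lemma cont_fst (U V : topologicalType) (f : T -> U * V) :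
  continuous f -> continuous (fun x => (f x).1).
Proof. by move=> fc; apply: (cont_comp _ fc) => x; exact: cvg_fst. Qed.

Lemma cont_snd (U V : topologicalType) (f : T -> U * V) :
  continuous f -> continuous (fun x => (f x).2).
Proof. by move=> fc; apply: (cont_comp _ fc) => x; exact: cvg_snd. Qed.

Lemma cont_add (f g : T -> R) :
  continuous f -> continuous g -> continuous (fun x => f x + g x).
Proof. by move=> fc gc x; apply: (@continuousD R R^o); [exact: fc|exact: gc]. Qed.

Lemma cont_mul (f g : T -> R) :
  continuous f -> continuous g -> continuous (fun x => f x * g x).
Proof. by move=> fc gc x; apply: continuousM; [exact: fc|exact: gc]. Qed.

Lemma cont_opp (f : T -> R) : continuous f -> continuous (fun x => - f x).
Proof. by move=> fc x; apply: (@continuousN R R^o); exact: fc. Qed.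

Lemma cont_cst (U : topologicalType) (c : U) : continuous (fun _ : T => c).
Proof. exact: cst_continuous. Qed.

Lemma cont_min (f g : T -> R) :
  continuous f -> continuous g -> continuous (fun x => Num.min (f x) (g x)).
Proof. by move=> fc gc x; apply: continuous_min; [exact: fc|exact: gc]. Qed.

Lemma cont_max (f g : T -> R) :
  continuous f -> continuous g -> continuous (fun x => Num.max (f x) (g x)).
Proof. by move=> fc gc x; apply: continuous_max; [exact: fc|exact: gc]. Qed.

End continuity_helpers.

Lemma cont_val (R : realType) (T : topologicalType) (f : T -> unit_interval R) :
  continuous f -> continuous (fun x => set_val (f x)).
Proof. by move=> fc; apply: (cont_comp (@set_val_continuous R) fc). Qed.

Lemma cont_clamp (R : realType) (T : topologicalType) (f : T -> R) :
  continuous f -> continuous (fun x => clamp (f x)).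
Proof. by move=> fc; apply: (cont_comp (@clamp_continuous R) fc). Qed.

Ltac cont_step := lazymatch goal with
  | |- forall _, continuous_at _ set_val => exact: set_val_continuous
  | |- forall _, continuous_at _ clamp => exact: clamp_continuous
  | |- forall _, continuous_at _ fst => move=> ?; exact: cvg_fst
  | |- forall _, continuous_at _ snd => move=> ?; exact: cvg_snd
  | |- forall _, continuous_at _ (fun _ => ?c) => exact: cont_cst
  | |- forall _, continuous_at _ (fun x => x) => exact: cont_id
  | |- forall _, continuous_at _ (fun x => GRing.add (@?f x) (@?g x)) =>
      apply: (@cont_add _ _ f g)
  | |- forall _, continuous_at _ (fun x => GRing.mul (@?f x) (@?g x)) =>
      apply: (@cont_mul _ _ f g)
  | |- forall _, continuous_at _ (fun x => GRing.opp (@?f x)) =>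
      apply: (@cont_opp _ _ f)
  | |- forall _, continuous_at _ (fun x => Order.min (@?f x) (@?g x)) =>
      apply: (@cont_min _ _ f g)
  | |- forall _, continuous_at _ (fun x => Order.max (@?f x) (@?g x)) =>
      apply: (@cont_max _ _ f g)
  | |- forall _, continuous_at _ (fun x => set_val (@?f x)) =>
      apply: (@cont_val _ _ f)
  | |- forall _, continuous_at _ (fun x => clamp (@?f x)) =>
      apply: (@cont_clamp _ _ f)
  | |- forall _, continuous_at _ (fun x => pair (@?f x) (@?g x)) =>
      apply: (@cont_pair _ _ _ f g)
  | |- forall _, continuous_at _ (fun x => fst (@?f x)) =>
      apply: (@cont_fst _ _ _ f)
  | |- forall _, continuous_at _ (fun x => snd (@?f x)) =>
      apply: (@cont_snd _ _ _ f)
  end.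

Ltac cont_tac := repeat first [assumption | cont_step].

Lemma clamp_le0 (R : realType) (t : R) : t <= 0 -> clamp t = itv0 R.
Proof.
move=> t0; apply: val_inj => /=; rewrite (min_idPr (le_trans t0 ler01)).
by rewrite (max_idPl t0) (min_idPr ler01) maxxx.
Qed.

Lemma clamp_ge1 (R : realType) (t : R) : 1 <= t -> clamp t = itv1 R.
Proof. by move=> t1; apply: val_inj => /=; rewrite (min_idPl t1) minxx. Qed.

Section loops.
Variables (R : realType) (X : topologicalType) (x : X).

Definition loop := {path (unit_interval R) from x to x in X}.

HB.instance Definition _ := Choice.on loop.

Implicit Types f g h k : loop.

Lemma loop_cont f : continuous (f : unit_interval R -> X).
Proof. exact: cts_fun. Qed.

Lemma loop_clamp_cont f (T : topologicalType) (a : T -> R) :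
  continuous a -> continuous (fun z => f (clamp (a z))).
Proof.
move=> ac.
exact: (cont_comp (@loop_cont f) (cont_clamp ac)).
Qed.

Lemma loop_clamp_le0 f (t : R) : t <= 0 -> f (clamp t) = x.
Proof. by move=> t0; rewrite clamp_le0//; exact: path_zero. Qed.

Lemma loop_clamp_ge1 f (t : R) : 1 <= t -> f (clamp t) = x.
Proof. by move=> t1; rewrite clamp_ge1//; exact: path_one. Qed.

Definition loop_cat_fun f g (t : unit_interval R) : X :=
  if set_val t <= 2^-1 then f (clamp (2 * set_val t))
  else g (clamp (2 * set_val t - 1)).

Lemma loop_cat_cont f g : continuous (loop_cat_fun f g).
Proof.
apply: continuous_if_le.
- by cont_tac.
- by apply: loop_clamp_cont; cont_tac.
- by apply: loop_clamp_cont; cont_tac.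
- move=> t ht; rewrite loop_clamp_ge1 ?loop_clamp_le0// ht; lra.
Qed.

Lemma loop_cat0 f g : loop_cat_fun f g zero = x.
Proof.
rewrite /loop_cat_fun clampE ?lexx ?ler01// ifT ?invr_ge0//.
by rewrite loop_clamp_le0// mulr0.
Qed.

Lemma loop_cat1 f g : loop_cat_fun f g one = x.
Proof.
rewrite /loop_cat_fun clampE ?lexx ?ler01// ifF; last by apply/negbTE; lra.
by rewrite loop_clamp_ge1//; lra.
Qed.

Definition loop_cat f g : loop :=
  mk_path (@loop_cat_cont f g) (loop_cat0 f g) (loop_cat1 f g).

Lemma loop_catE f g t : loop_cat f g t =
  if set_val t <= 2^-1 then f (clamp (2 * set_val t))
  else g (clamp (2 * set_val t - 1)).
Proof. by []. Qed.

Definition loop_rev_fun f (t : unit_interval R) : X := f (clamp (1 - set_val t)).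

Lemma loop_rev_cont f : continuous (loop_rev_fun f).
Proof.
by apply: loop_clamp_cont; cont_tac.
Qed.

Lemma loop_rev0 f : loop_rev_fun f zero = x.
Proof. by rewrite /loop_rev_fun loop_clamp_ge1// clampE ?lexx ?ler01//; lra. Qed.

Lemma loop_rev1 f : loop_rev_fun f one = x.
Proof. by rewrite /loop_rev_fun loop_clamp_le0// clampE ?lexx ?ler01//; lra. Qed.

Definition loop_rev f : loop :=
  mk_path (@loop_rev_cont f) (loop_rev0 f) (loop_rev1 f).

Lemma loop_revE f t : loop_rev f t = f (clamp (1 - set_val t)).
Proof. by []. Qed.

Definition loop_cst : loop := (cst x : unit_interval R -> X).

Definition homotopic f g : Prop :=
  exists H : unit_interval R * unit_interval R -> X,
    [/\ continuous H,
        forall t, H (itv0 R, t) = f t,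
        forall t, H (itv1 R, t) = g t &
        forall s, H (s, itv0 R) = x /\ H (s, itv1 R) = x].

Lemma homotopic_reparam (F : R -> X) (a b : R -> R) f g :
  continuous F -> continuous a -> continuous b ->
  (forall t, f t = F (a (set_val t))) -> (forall t, g t = F (b (set_val t))) ->
  (forall s, 0 <= s <= 1 -> F ((1 - s) * a 0 + s * b 0) = x) ->
  (forall s, 0 <= s <= 1 -> F ((1 - s) * a 1 + s * b 1) = x) ->
  homotopic f g.
Proof.
move=> Fc ac bc fF gF F0 F1.
exists (fun st => F ((1 - set_val st.1) * a (set_val st.2)
                     + set_val st.1 * b (set_val st.2))); split=> /=.
- by apply: (cont_comp Fc); cont_tac; [apply: (cont_comp ac)|
    apply: (cont_comp bc)]; cont_tac.
- by move=> t; rewrite clampE ?lexx ?ler01// fF; congr F; ring.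
- by move=> t; rewrite clampE ?lexx ?ler01// gF; congr F; ring.
- move=> s; rewrite !clampE ?lexx ?ler01//.
  by split; [apply: F0|apply: F1]; exact: itv_bounds.
Qed.

Lemma homotopic_eq f g : f =1 g -> homotopic f g.
Proof.
move=> fg; exists (fun st => f st.2); split=> //=.
- by apply: (cont_comp (@loop_cont f)); cont_tac.
- by move=> _; split; [exact: path_zero|exact: path_one].
Qed.

Lemma homotopic_refl f : homotopic f f.
Proof. exact: homotopic_eq. Qed.

Lemma homotopic_sym f g : homotopic f g -> homotopic g f.
Proof.
move=> [H [Hc H0 H1 Hx]].
exists (fun st => H (clamp (1 - set_val st.1), st.2)); split=> /=.
- by apply: (cont_comp Hc); cont_tac.
- by move=> t; rewrite clampE ?lexx ?ler01// subr0; exact: H1.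
- by move=> t; rewrite clampE ?lexx ?ler01// subrr; exact: H0.
- by move=> s; exact: Hx.
Qed.

Lemma homotopic_trans g f h : homotopic f g -> homotopic g h -> homotopic f h.
Proof.
move=> [H [Hc H0 H1 Hx]] [K [Kc K0 K1 Kx]].
exists (fun st => if set_val st.1 <= 2^-1 then H (clamp (2 * set_val st.1), st.2)
                  else K (clamp (2 * set_val st.1 - 1), st.2)); split=> /=.
- apply: continuous_if_le.
  + by cont_tac.
  + by apply: (cont_comp Hc); cont_tac.
  + by apply: (cont_comp Kc); cont_tac.
  + move=> [s t] /= ->; rewrite clamp_ge1; last lra.
    by rewrite clamp_le0; [rewrite H1 K0|lra].
- move=> t; rewrite clampE ?lexx ?ler01// ifT ?invr_ge0//.
  by rewrite clamp_le0 ?mulr0.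
- move=> t; rewrite clampE ?lexx ?ler01// ifF; last by apply/negbTE; lra.
  by rewrite clamp_ge1//; lra.
- by move=> s; split; case: ifP => _;
    solve [exact: (Hx _).1|exact: (Hx _).2|exact: (Kx _).1|exact: (Kx _).2].
Qed.

Lemma homotopic_cat f f' g g' : homotopic f f' -> homotopic g g' ->
  homotopic (loop_cat f g) (loop_cat f' g').
Proof.
move=> [H [Hc H0 H1 Hx]] [K [Kc K0 K1 Kx]].
exists (fun st => if set_val st.2 <= 2^-1 then H (st.1, clamp (2 * set_val st.2))
                  else K (st.1, clamp (2 * set_val st.2 - 1))); split=> /=.
- apply: continuous_if_le.
  + by cont_tac.
  + by apply: (cont_comp Hc); cont_tac.
  + by apply: (cont_comp Kc); cont_tac.
  + move=> [s t] /= ->; rewrite clamp_ge1; last lra.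
    by rewrite clamp_le0; [rewrite (Hx _).2 (Kx _).1|lra].
- by move=> t; rewrite /mk_path /loop_cat_fun H0 K0.
- by move=> t; rewrite /mk_path /loop_cat_fun H1 K1.
- move=> s; split; rewrite clampE ?lexx ?ler01//.
    by rewrite ifT ?invr_ge0// mulr0 clamp_le0// (Hx _).1.
  rewrite ifF; last by apply/negbTE; lra.
  by rewrite clamp_ge1 ?(Kx _).2//; lra.
Qed.

Lemma homotopic_rev f f' : homotopic f f' -> homotopic (loop_rev f) (loop_rev f').
Proof.
move=> [H [Hc H0 H1 Hx]].
exists (fun st => H (st.1, clamp (1 - set_val st.2))); split=> /=.
- by apply: (cont_comp Hc); cont_tac.
- by move=> t; rewrite H0.
- by move=> t; rewrite H1.
- move=> s; rewrite !clampE ?lexx ?ler01// subr0 subrr.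
  by split; [exact: (Hx _).2|exact: (Hx _).1].
Qed.

Lemma homotopic_catA f g h :
  homotopic (loop_cat f (loop_cat g h)) (loop_cat (loop_cat f g) h).
Proof.
pose F t := if t <= 1 then f (clamp t) else
            if t <= 2 then g (clamp (t - 1)) else h (clamp (t - 2)).
have Fc : continuous F.
  apply: continuous_if_le.
  - by cont_tac.
  - by apply: loop_clamp_cont; cont_tac.
  - apply: continuous_if_le.
    + by cont_tac.
    + by apply: loop_clamp_cont; cont_tac.
    + by apply: loop_clamp_cont; cont_tac.
    + by move=> t ->; rewrite loop_clamp_ge1 ?loop_clamp_le0//; lra.
  - move=> t ->; rewrite ifT; last lra.
    by rewrite loop_clamp_ge1 ?loop_clamp_le0//; lra.
have F0 t : t <= 0 -> F t = x.
  by move=> t0; rewrite /F ifT; [exact: loop_clamp_le0|lra].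
have F3 t : 3 <= t -> F t = x.
  move=> t3; rewrite /F ifF; last by apply/negbTE; lra.
  rewrite ifF; last by apply/negbTE; lra.
  by apply: loop_clamp_ge1; lra.
apply: (@homotopic_reparam F (fun t => Num.max (2 * t + 0) (4 * t + -1))
                             (fun t => Num.min (4 * t + 0) (2 * t + 1))) => //.
- by cont_tac.
- by cont_tac.
- move=> t; have /andP[t0 t1] := itv_bounds t.
  rewrite !loop_catE /F.
  set v := set_val t in t0 t1 *.
  case: (leP v 2^-1) => [vh|vh].
    rewrite (max_idPl _); last lra.
    by rewrite ifT ?addr0//; lra.
  rewrite (max_idPr _); last lra.
  rewrite clampE; last lra.
  rewrite [in RHS]ifF; last by apply/negbTE; lra.
  case: (leP (2 * v - 1) 2^-1) => [vq|vq].
    rewrite ifT; last lra.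
    by congr (g (clamp _)); ring.
  rewrite ifF; last by apply/negbTE; lra.
  by congr (h (clamp _)); ring.
- move=> t; have /andP[t0 t1] := itv_bounds t.
  rewrite !loop_catE /F.
  set v := set_val t in t0 t1 *.
  case: (leP v 2^-1) => [vh|vh].
    rewrite (min_idPl _); last lra.
    rewrite clampE; last lra.
    case: (leP (2 * v) 2^-1) => [vq|vq].
      rewrite ifT; last lra.
      by congr (f (clamp _)); ring.
    rewrite ifF; last by apply/negbTE; lra.
    rewrite ifT; last lra.
    by congr (g (clamp _)); ring.
  rewrite (min_idPr _); last lra.
  rewrite ifF; last by apply/negbTE; lra.
  rewrite ifF; last by apply/negbTE; lra.
  by congr (h (clamp _)); ring.
- move=> s _; apply: F0; rewrite (max_idPl _); last lra.
  by rewrite (min_idPl _); lra.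
- move=> s _; apply: F3; rewrite (max_idPr _); last lra.
  by rewrite (min_idPr _); lra.
Qed.

Lemma homotopic_cst_cat f : homotopic (loop_cat loop_cst f) f.
Proof.
apply: (@homotopic_reparam (fun t => f (clamp t)) (fun t => 2 * t - 1) id) => //.
- by apply: loop_clamp_cont; cont_tac.
- by cont_tac.
- by cont_tac.
- move=> t; rewrite loop_catE; case: ifP => // th.
  by rewrite (@loop_clamp_le0 f)//; lra.
- by move=> t /=; rewrite clampK.
- by move=> s s01; rewrite /= loop_clamp_le0//; lra.
- by move=> s s01; rewrite /= loop_clamp_ge1//; lra.
Qed.

Lemma homotopic_cat_cst f : homotopic (loop_cat f loop_cst) f.
Proof.
apply: (@homotopic_reparam (fun t => f (clamp t)) (fun t => 2 * t) id) => //.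
- by apply: loop_clamp_cont; cont_tac.
- by cont_tac.
- by cont_tac.
- move=> t; rewrite loop_catE; case: leP => // th.
  by rewrite (@loop_clamp_ge1 f)//; lra.
- by move=> t /=; rewrite clampK.
- by move=> s s01; rewrite /= loop_clamp_le0//; lra.
- by move=> s s01; rewrite /= loop_clamp_ge1//; lra.
Qed.

Lemma homotopic_cat_rev f : homotopic (loop_cat f (loop_rev f)) loop_cst.
Proof.
apply: (@homotopic_reparam (fun t => f (clamp t))
  (fun t => Num.min (2 * t + 0) (- 2 * t + 2)) (fun=> 0)) => //.
- by apply: loop_clamp_cont; cont_tac.
- by cont_tac.
- by cont_tac.
- move=> t; have /andP[t0 t1] := itv_bounds t.
  rewrite loop_catE !loop_revE.
  set v := set_val t in t0 t1 *.
  case: (leP v 2^-1) => [vh|vh].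
    by rewrite (min_idPl _) ?addr0//; lra.
  rewrite (min_idPr _); last lra.
  by rewrite clampE; [congr (f (clamp _)); ring|lra].
- by move=> t; rewrite /= loop_clamp_le0.
- by move=> s s01; rewrite (min_idPl _) ?loop_clamp_le0//=; lra.
- by move=> s s01; rewrite (min_idPr _) ?loop_clamp_le0//=; lra.
Qed.

Lemma loop_revK f : loop_rev (loop_rev f) =1 f.
Proof.
move=> t; have t01 := itv_bounds t.
rewrite !loop_revE clampE; last lra.
by rewrite opprB addrCA subrr addr0 clampK.
Qed.

Lemma homotopic_rev_cat f : homotopic (loop_cat (loop_rev f) f) loop_cst.
Proof.
apply: homotopic_trans (homotopic_cat_rev (loop_rev f)).
apply: homotopic_cat; first exact: homotopic_refl.
by apply: homotopic_sym; apply: homotopic_eq; exact: loop_revK.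
Qed.

End loops.

Section fundamental_group.
Variables (R : realType) (X : topologicalType) (x : X).

Definition homotopicb (f g : loop R x) : bool := `[< homotopic f g >].

Lemma homotopicb_equiv : equiv_class_of homotopicb.
Proof.
split=> [f|f g|g f h].
- exact/asboolP/homotopic_refl.
- by apply/asboolP/asboolP => /homotopic_sym.
- by move=> /asboolP fg /asboolP gh; apply/asboolP; exact: homotopic_trans fg gh.
Qed.

Canonical homotopic_equiv := EquivRelPack homotopicb_equiv.

Local Open Scope quotient_scope.

Definition pi1 : Type := {eq_quot homotopic_equiv}.

HB.instance Definition _ := Choice.on pi1.
HB.instance Definition _ := EqQuotient.on pi1.

Definition pi1_class (f : loop R x) : pi1 := \pi_pi1 f.

Lemma pi1_classP f g : pi1_class f = pi1_class g <-> homotopic f g.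
Proof.
split=> [/eqP|fg]; first by rewrite /pi1_class eqmodE => /asboolP.
by apply/eqP; rewrite /pi1_class eqmodE; exact/asboolP.
Qed.

Lemma pi1_ind (c : pi1) : exists f, c = pi1_class f.
Proof. by exists (repr c); rewrite /pi1_class reprK. Qed.

Lemma pi1_repr f : homotopic (repr (pi1_class f)) f.
Proof. by apply/pi1_classP; rewrite /pi1_class reprK. Qed.

Definition pi1_mul (c d : pi1) : pi1 :=
  pi1_class (loop_cat (repr c) (repr d)).
Definition pi1_inv (c : pi1) : pi1 := pi1_class (loop_rev (repr c)).
Definition pi1_one : pi1 := pi1_class (loop_cst R x).

Lemma pi1_mul_class f g :
  pi1_mul (pi1_class f) (pi1_class g) = pi1_class (loop_cat f g).
Proof. by apply/pi1_classP; apply: homotopic_cat; exact: pi1_repr. Qed.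

Lemma pi1_inv_class f : pi1_inv (pi1_class f) = pi1_class (loop_rev f).
Proof. by apply/pi1_classP; apply: homotopic_rev; exact: pi1_repr. Qed.

Lemma pi1_mulA : associative pi1_mul.
Proof.
move=> c d e; have [f ->] := pi1_ind c; have [g ->] := pi1_ind d.
have [h ->] := pi1_ind e; rewrite !pi1_mul_class.
by apply/pi1_classP; exact: homotopic_catA.
Qed.

Lemma pi1_mul1 : left_id pi1_one pi1_mul.
Proof.
move=> c; have [f ->] := pi1_ind c; rewrite pi1_mul_class.
by apply/pi1_classP; exact: homotopic_cst_cat.
Qed.

Lemma pi1_mulr1 : right_id pi1_one pi1_mul.
Proof.
move=> c; have [f ->] := pi1_ind c; rewrite pi1_mul_class.
by apply/pi1_classP; exact: homotopic_cat_cst.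
Qed.

Lemma pi1_mulV : left_inverse pi1_one pi1_inv pi1_mul.
Proof.
move=> c; have [f ->] := pi1_ind c; rewrite pi1_inv_class pi1_mul_class.
by apply/pi1_classP; exact: homotopic_rev_cat.
Qed.

Lemma pi1_mulrV : right_inverse pi1_one pi1_inv pi1_mul.
Proof.
move=> c; have [f ->] := pi1_ind c; rewrite pi1_inv_class pi1_mul_class.
by apply/pi1_classP; exact: homotopic_cat_rev.
Qed.

HB.instance Definition _ := isGroup.Build pi1
  pi1_mulA pi1_mul1 pi1_mulr1 pi1_mulV pi1_mulrV.

Lemma pi1_mulE (c d : pi1) : (c * d)%g = pi1_mul c d.
Proof. by []. Qed.

End fundamental_group.

Section induced_map.
Variables (R : realType) (X Y : topologicalType) (x : X) (y : Y).
Variables (f : X -> Y) (f_cont : continuous f) (fxy : f x = y).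

Lemma loop_map_cont (l : loop R x) : continuous (f \o l).
Proof. exact: cont_comp f_cont (@loop_cont _ _ _ l). Qed.

Lemma loop_map0 (l : loop R x) : (f \o l) zero = y.
Proof. by rewrite /= path_zero. Qed.

Lemma loop_map1 (l : loop R x) : (f \o l) one = y.
Proof. by rewrite /= path_one. Qed.

Definition loop_map (l : loop R x) : loop R y :=
  mk_path (@loop_map_cont l) (loop_map0 l) (loop_map1 l).

Definition pi1_map (c : pi1 R x) : pi1 R y := pi1_class (loop_map (repr c)).

Lemma loop_mapE l t : loop_map l t = f (l t).
Proof. by []. Qed.

Lemma homotopic_map l m : homotopic l m -> homotopic (loop_map l) (loop_map m).
Proof.
move=> [H [Hc H0 H1 Hx]]; exists (fun st => f (H st)); split.
- exact: (cont_comp f_cont Hc).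
- by move=> t; rewrite loop_mapE H0.
- by move=> t; rewrite loop_mapE H1.
- by move=> s; rewrite (Hx s).1 (Hx s).2.
Qed.

Lemma pi1_map_class l : pi1_map (pi1_class l) = pi1_class (loop_map l).
Proof. by apply/pi1_classP; apply: homotopic_map; exact: pi1_repr. Qed.

Lemma pi1_map_mul : {morph pi1_map : c d / (c * d)%g}.
Proof.
move=> c d; have [l ->] := pi1_ind c; have [m ->] := pi1_ind d.
rewrite !pi1_mulE pi1_mul_class !pi1_map_class pi1_mul_class.
apply/pi1_classP; apply: homotopic_eq => t.
by rewrite !(loop_catE, loop_mapE); case: ifP.
Qed.

HB.instance Definition _ :=
  isMultiplicative.Build (pi1 R x) (pi1 R y) pi1_map pi1_map_mul.

End induced_map.

(* Actions are right actions, as in [fingroup.action], and the semidirect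
   product has the multiplication of [sdprod_by] in [gproduct]:
   (h1, n1) (h2, n2) = (h1 h2, phi n1 h2 n2), so that phi n h is the conjugate
   n ^ h = h^-1 n h in the product.  As loops are composed from left to right,
   this is the transport of n forward along the loop h. *)
Record group_action (N H : groupType) := GroupAction {
  gact :> N -> H -> N;
  gact1 : forall n, gact n 1%g = n;
  gactM : forall n h1 h2, gact n (h1 * h2)%g = gact (gact n h1) h2;
  gact_mul : forall h n1 n2, gact (n1 * n2)%g h = (gact n1 h * gact n2 h)%g }.

Record sdprod (N H : groupType) (phi : group_action N H) :=
  Sdprod { sd_base : H; sd_fiber : N }.

Section semidirect_product.
Variables (N H : groupType) (phi : group_action N H).

Notation sdT := (sdprod phi).

HB.instance Definition _ := gen_eqMixin sdT.
HB.instance Definition _ := gen_choiceMixin sdT.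

Definition sd_mul (u v : sdT) : sdT :=
  Sdprod phi (sd_base u * sd_base v)%g
            (phi (sd_fiber u) (sd_base v) * sd_fiber v)%g.
Definition sd_one : sdT := Sdprod phi 1%g 1%g.
Definition sd_inv (u : sdT) : sdT :=
  Sdprod phi (sd_base u)^-1%g (phi (sd_fiber u)^-1%g (sd_base u)^-1%g).

Lemma gact1g h : phi 1%g h = 1%g.
Proof. by apply: (@mulgI _ (phi 1%g h)); rewrite -gact_mul !mulg1. Qed.

Lemma sd_mulA : associative sd_mul.
Proof.
by move=> u v w; rewrite /sd_mul /= gact_mul gactM !mulgA.
Qed.

Lemma sd_mul1 : left_id sd_one sd_mul.
Proof. by case=> h n; rewrite /sd_mul /= gact1g !mul1g. Qed.

Lemma sd_mulr1 : right_id sd_one sd_mul.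
Proof. by case=> h n; rewrite /sd_mul /= gact1 !mulg1. Qed.

Lemma sd_mulV : left_inverse sd_one sd_inv sd_mul.
Proof.
case=> h n; rewrite /sd_mul /= -gactM !mulVg gact1.
by rewrite mulVg.
Qed.

Lemma sd_mulrV : right_inverse sd_one sd_inv sd_mul.
Proof. by case=> h n; rewrite /sd_mul /= -gact_mul !mulgV gact1g. Qed.

HB.instance Definition _ := isGroup.Build sdT
  sd_mulA sd_mul1 sd_mulr1 sd_mulV sd_mulrV.

Definition sd_inl (n : N) : sdT := Sdprod phi 1%g n.
Definition sd_inr (h : H) : sdT := Sdprod phi h 1%g.

End semidirect_product.

Section exact_sequences.
Variables (N G H : groupType).

Definition short_exact (i : {multiplicative N -> G}) (q : {multiplicative G -> H}) :=
  [/\ injective i, (forall y, q y = 1%g <-> exists n, i n = y)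
    & forall h, exists y, q y = h].

End exact_sequences.

Definition commutator_product (G : groupType) (g : nat) (a b : 'I_g -> G) : G :=
  (\prod_(i < g) (a i * b i * (a i)^-1 * (b i)^-1))%g.

(* G is presented by < a_i, b_i | prod_i [a_i, b_i] = 1 >, expressed by the
   universal property of the presentation. *)
Definition surface_presentation (G : groupType) (g : nat) (a b : 'I_g -> G) :=
  commutator_product a b = 1%g /\
  forall (K : groupType) (a' b' : 'I_g -> K), commutator_product a' b' = 1%g ->
  exists h : {multiplicative G -> K},
    (forall i, h (a i) = a' i /\ h (b i) = b' i) /\
    forall h' : {multiplicative G -> K},
      (forall i, h' (a i) = a' i /\ h' (b i) = b' i) -> h' =1 h.

Section surfaces.
Variables (R : realType).

Fixpoint smooth_upto (n : nat) (U : set (R * R)) (f : R * R -> R) : Prop :=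
  (forall z, U z -> {for z, continuous f}) /\
  (if n is n'.+1 then
     forall e : R * R, e = (1, 0) \/ e = (0, 1) ->
       (forall z, U z -> derivable f z e) /\ smooth_upto n' U ('D_e f)
   else True).

(* C^infinity on an open set U of the plane: all iterated partial derivatives
   exist and are continuous on U. *)
Definition smooth_on (U : set (R * R)) (f : R * R -> R) :=
  forall n, smooth_upto n U f.

Definition jacobian (f : R * R -> R * R) (z : R * R) : R :=
  'D_(1, 0) (fun w => (f w).1) z * 'D_(0, 1) (fun w => (f w).2) z
  - 'D_(0, 1) (fun w => (f w).1) z * 'D_(1, 0) (fun w => (f w).2) z.

Variable S : topologicalType.

Record chart := Chart {
  chart_dom : set S;
  chart_map : S -> R * R;
  chart_inv : R * R -> S }.

Definition chart_cod (c : chart) : set (R * R) := chart_map c @` chart_dom c.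

Definition is_chart (c : chart) :=
  [/\ open (chart_dom c), open (chart_cod c),
      {in chart_dom c, cancel (chart_map c) (chart_inv c)},
      {within chart_dom c, continuous (chart_map c)}
    & {within chart_cod c, continuous (chart_inv c)}].

Definition oriented_smooth_atlas (A : set chart) :=
  [/\ (forall c, A c -> is_chart c),
      (forall x, exists2 c, A c & chart_dom c x)
    & forall c d, A c -> A d ->
        let W := chart_map c @` (chart_dom c `&` chart_dom d) in
        let f := chart_map d \o chart_inv c in
        [/\ smooth_on W (fun w => (f w).1), smooth_on W (fun w => (f w).2)
          & forall w, W w -> 0 < jacobian f w]].

Definition closed_connected_oriented_surface (A : set chart) :=
  [/\ hausdorff_space S, compact [set: S], connected [set: S]
    & oriented_smooth_atlas A].

Definition smooth_function (A : set chart) (f : S -> R) :=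
  forall c, A c -> smooth_on (chart_cod c) (f \o chart_inv c).

(* A map to the circle of unit complex numbers is smooth when its real and
   imaginary parts are. *)
Definition smooth_circle_map (A : set chart) (u : S -> R[i]) :=
  [/\ forall x, `|u x| = 1,
      smooth_function A (fun x => complex.Re (u x))
    & smooth_function A (fun x => complex.Im (u x))].

Definition unit_disk : set (R * R) := [set z | z.1 ^+ 2 + z.2 ^+ 2 <= 1].

(* The unit circle is cut into 4g arcs; this is the point at parameter s of
   the k-th one, run counterclockwise. *)
Definition polygon_edge (g k : nat) (s : R) : R * R :=
  let t := 2 * pi * (k%:R + s) / (4 * g)%:R in (cos t, sin t).

(* The identifications along the boundary word
   prod_i a_i b_i a_i^-1 b_i^-1 of the 4g-gon. *)
Inductive polygon_glued (g : nat) : R * R -> R * R -> Prop :=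
| glued_a (i : 'I_g) (s : R) : 0 <= s <= 1 ->
    polygon_glued g (polygon_edge g (4 * i) s)
                    (polygon_edge g (4 * i + 2) (1 - s))
| glued_b (i : 'I_g) (s : R) : 0 <= s <= 1 ->
    polygon_glued g (polygon_edge g (4 * i + 1) s)
                    (polygon_edge g (4 * i + 3) (1 - s))
| glued_refl z : polygon_glued g z z
| glued_sym z w : polygon_glued g z w -> polygon_glued g w z
| glued_trans z w v :
    polygon_glued g z w -> polygon_glued g w v -> polygon_glued g z v.

(* For g >= 1 and S Hausdorff this says that S is homeomorphic to the
   4g-gon modulo the identifications above: a continuous surjection from a
   compact space to a Hausdorff space is a quotient map. *)
Definition has_genus (g : nat) :=
  exists q : R * R -> S,
    [/\ {within unit_disk, continuous q}, q @` unit_disk = [set: S]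
      & forall z w, unit_disk z -> unit_disk w ->
          (q z = q w <-> polygon_glued g z w)].

End surfaces.

Section degree.
Variables (R : realType) (S : topologicalType) (x : S).

Definition expi (t : R) : R[i] := (cos t +i* sin t)%C.

Definition winding_number (u : S -> R[i]) (l : loop R x) (n : int) :=
  exists theta : unit_interval R -> R,
    [/\ continuous theta, forall t, u (l t) = expi (2 * pi * theta t)
      & theta (itv1 R) - theta (itv0 R) = n%:~R].

(* u_* : pi_1(S, x) -> pi_1(S^1) = Z; the winding number of u along a loop
   exists, is unique and depends only on the class of the loop. *)
Definition circle_map_pi1 (u : S -> R[i]) (c : pi1 R x) : int :=
  xget 0 [set n | exists2 l : loop R x, pi1_class l = c & winding_number u l n].

(* H^1(S; Z) is taken as Hom(pi_1(S, x), Z), where the class represented by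
   u : S -> S^1 is u_*. *)
Definition primitive_class (c : pi1 R x -> int) :=
  forall (n : int) (d : pi1 R x -> int),
    (forall y z, d (y * z)%g = d y + d z) -> (forall y, c y = n * d y) ->
    n = 1 \/ n = -1.

End degree.

Section sphere.
Variable R : realType.

Definition dot3 (v w : R * R * R) : R :=
  v.1.1 * w.1.1 + v.1.2 * w.1.2 + v.2 * w.2.

Definition sphere2 : set (R * R * R) := [set v | dot3 v v = 1].

Definition north_vec : R * R * R := (0, 0, 1).

Lemma north_subproof : north_vec \in sphere2.
Proof. by rewrite inE /sphere2 /dot3 /= !mul0r !add0r mulr1. Qed.

Definition north : sphere2 := SigSub north_subproof.

Definition equator_point (z : R[i]) : R * R * R :=
  (complex.Re z, complex.Im z, 0).

Definition rot_vec (t : R) (v : R * R * R) : R * R * R :=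
  (cos t * v.1.1 - sin t * v.1.2, sin t * v.1.1 + cos t * v.1.2, v.2).

Lemma dot3_rot t v w : dot3 (rot_vec t v) (rot_vec t w) = dot3 v w.
Proof.
rewrite /dot3 /=; have := cos2Dsin2 t; set c := cos t; set s := sin t => cs.
transitivity ((c ^+ 2 + s ^+ 2) * (v.1.1 * w.1.1 + v.1.2 * w.1.2) + v.2 * w.2).
  by ring.
by rewrite cs mul1r.
Qed.

Lemma sphere_rot_subproof t (v : sphere2) : rot_vec t (set_val v) \in sphere2.
Proof. by rewrite inE /sphere2 /= dot3_rot; have := set_mem (valP v). Qed.

Definition sphere_rot (t : R) (v : sphere2) : sphere2 := SigSub (sphere_rot_subproof t v).

Lemma sphere_rotE t v : set_val (sphere_rot t v) = rot_vec t (set_val v).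
Proof. by []. Qed.

(* The points of the equator whose p-th power is w. *)
Definition equatorial_roots (p : nat) (w : R[i]) : set sphere2 :=
  [set v | exists z : R[i],
     [/\ `|z| = 1, z ^+ p = w & set_val v = equator_point z]].

(* The union of the open round disks of angular radius rho centered at the
   points of A. *)
Definition disks (rho : R) (A : set sphere2) : set sphere2 :=
  [set v | exists2 c, A c & cos rho < dot3 (set_val v) (set_val c)].

(* P_p, the disks being centered at the p points of the equator over w. *)
Definition planar_fiber (p : nat) (rho : R) (w : R[i]) : set sphere2 :=
  ~` disks rho (equatorial_roots p w).

End sphere.

Arguments sphere2 : clear implicits.
Arguments north {R}.
Arguments equator_point {R}.

Section complement.
Variables (R : realType) (S : topologicalType).

Definition multisection (p : nat) (u : S -> R[i]) : set (S * sphere2 R) :=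
  [set y | exists z : R[i],
     [/\ `|z| = 1, z ^+ p = u y.1 & set_val y.2 = equator_point z]].

(* Interior of the tubular neighborhood: over each point of S, the open disks
   of angular radius rho around the points of the multisection. *)
Definition open_tube (p : nat) (rho : R) (u : S -> R[i]) :
    set (S * sphere2 R) :=
  [set y | disks rho [set v | multisection p u (y.1, v)] y.2].

Definition multisection_complement (p : nat) (rho : R) (u : S -> R[i]) :
    set (S * sphere2 R) :=
  ~` open_tube p rho u.

End complement.

(* The disks of radius rho around p equally spaced points of the equator are
   pairwise disjoint. *)
Definition small_radius (R : realType) (p : nat) (rho : R) :=
  0 < rho < pi / p%:R.

Section based_maps.
Variables (R : realType) (p : nat) (rho : R).
Hypotheses (p_ge2 : (2 <= p)%N) (rho_small : small_radius p rho).

Lemma small_radius_cos : 0 <= cos rho.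
Proof.
have /andP[rho0 rhop] := rho_small.
apply: cos_ge0_pihalf; apply/andP; split.
  apply: le_trans (ltW rho0); rewrite oppr_le0.
  by rewrite divr_ge0// pi_ge0.
apply/ltW/(lt_le_trans rhop); rewrite ler_pM2l ?pi_gt0//.
by rewrite lef_pV2 ?posrE ?ltr0n// ?ler_nat// (leq_trans _ p_ge2).
Qed.

Lemma north_notin_disks w : ~ disks rho (equatorial_roots p w) (@north R).
Proof.
move=> [c [z [_ _ cz]]]; rewrite cz /dot3 /= !mul0r mulr0 !addr0.
by rewrite ltNge small_radius_cos.
Qed.

Lemma fiber_north_subproof w : @north R \in planar_fiber p rho w.
Proof. by rewrite inE; exact: north_notin_disks. Qed.

Definition fiber_north w : planar_fiber p rho w :=
  SigSub (fiber_north_subproof w).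

Lemma expiX t n : expi t ^+ n = expi (t *+ n) :> R[i].
Proof.
elim: n => [|n IHn]; first by rewrite expr0 mulr0n /expi cos0 sin0.
rewrite exprS IHn mulrS /expi cosD sinD; apply/eqP; rewrite eq_complex /=.
by rewrite eqxx /= addrC [cos t * _]mulrC.
Qed.

Lemma norm_expi t : `|expi t| = 1 :> R[i].
Proof. by rewrite /expi normc_def /= cos2Dsin2 sqrtr1. Qed.

Lemma rot_equator t (z : R[i]) :
  rot_vec t (equator_point z) = equator_point (expi t * z).
Proof.
by case: z => a b; rewrite /rot_vec /equator_point /=; congr (_, _, _); ring.
Qed.

Definition rot_angle : R := 2 * pi / p%:R.

Lemma rot_roots w (c : sphere2 R) : equatorial_roots p w c ->
  equatorial_roots p w (sphere_rot (- rot_angle) c).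
Proof.
move=> [z [z1 zw cz]]; exists (expi (- rot_angle) * z); split.
- by rewrite normrM norm_expi mul1r.
- rewrite exprMn zw expiX.
  suff -> : expi (- rot_angle *+ p) = 1 by rewrite mul1r.
  rewrite mulNrn -mulr_natr /rot_angle divfK; last first.
    by rewrite pnatr_eq0 -lt0n (leq_trans _ p_ge2).
  by rewrite /expi cosN sinN mulr_natl cos2pi sin2pi oppr0.
- by rewrite sphere_rotE cz rot_equator.
Qed.

Lemma rotNK t (v : R * R * R) : rot_vec (- t) (rot_vec t v) = v.
Proof.
have := cos2Dsin2 t; case: v => [[a b] d]; rewrite /rot_vec /= cosN sinN.
set c := cos t; set s := sin t => cs; congr (_, _, _).
  by transitivity ((c ^+ 2 + s ^+ 2) * a); [ring|rewrite cs mul1r].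
by transitivity ((c ^+ 2 + s ^+ 2) * b); [ring|rewrite cs mul1r].
Qed.

Lemma fiber_rot_subproof w (v : planar_fiber p rho w) :
  sphere_rot rot_angle (set_val v) \in planar_fiber p rho w.
Proof.
rewrite inE => -[c cw hc].
apply: (set_mem (valP v)); exists (sphere_rot (- rot_angle) c); first exact: rot_roots.
by rewrite sphere_rotE -(rotNK rot_angle (set_val (set_val v))) dot3_rot -sphere_rotE.
Qed.

Definition fiber_rot w (v : planar_fiber p rho w) : planar_fiber p rho w :=
  SigSub (fiber_rot_subproof v).

Lemma fiber_rot_north w : fiber_rot (fiber_north w) = fiber_north w.
Proof.
by do 2![apply: val_inj => /=]; rewrite /rot_vec /= !mulr0 subr0 addr0.
Qed.

Lemma sig_cont (T U : topologicalType) (A : set U) (f : T -> A) :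
  continuous (fun t => set_val (f t)) -> continuous f.
Proof. by move=> fc; apply: (@continuous_comp_initial _ _ _ (set_val : A -> U)). Qed.

Lemma sig_val_cont (U : topologicalType) (A : set U) :
  continuous (set_val : A -> U).
Proof. exact: initial_continuous. Qed.

Lemma rot_cont t : continuous (sphere_rot t : sphere2 R -> sphere2 R).
Proof.
apply: sig_cont; have vc := @sig_val_cont _ (@sphere2 R).
have c1 := cont_fst vc; have c11 := cont_fst c1; have c12 := cont_snd c1.
have c2 := cont_snd vc.
by apply: cont_pair => //; apply: cont_pair; cont_tac.
Qed.

Lemma fiber_rot_cont w : continuous (@fiber_rot w).
Proof.
apply: sig_cont.
exact: (cont_comp (@rot_cont rot_angle) (@sig_val_cont _ (planar_fiber p rho w))).
Qed.

Definition fiber_rot_pi1 w := pi1_map (R := R) (@fiber_rot_cont w) (fiber_rot_north w).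

Variables (S : topologicalType) (u : S -> R[i]).

Notation M := (multisection_complement p rho u).

Lemma complement_north_subproof x : (x, @north R) \in M.
Proof. by rewrite inE; exact: (@north_notin_disks (u x)). Qed.

Definition complement_north x : M := SigSub (complement_north_subproof x).

Lemma fiber_incl_subproof x (v : planar_fiber p rho (u x)) :
  (x, set_val v) \in M.
Proof. by rewrite inE; exact: (set_mem (valP v)). Qed.

Definition fiber_incl x (v : planar_fiber p rho (u x)) : M :=
  SigSub (fiber_incl_subproof v).

Lemma fiber_incl_cont x : continuous (@fiber_incl x).
Proof.
apply: sig_cont; apply: cont_pair; first exact: cont_cst.
exact: sig_val_cont.
Qed.

Lemma fiber_incl_north x : fiber_incl (fiber_north (u x)) = complement_north x.
Proof. exact: val_inj. Qed.

Definition fiber_incl_pi1 x :=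
  pi1_map (R := R) (@fiber_incl_cont x) (fiber_incl_north x).

Definition bundle_proj (y : M) : S := (set_val y).1.

Lemma bundle_proj_cont : continuous bundle_proj.
Proof. exact: (cont_fst (@sig_val_cont _ M)). Qed.

Lemma bundle_proj_north x : bundle_proj (complement_north x) = x.
Proof. by []. Qed.

Definition bundle_proj_pi1 x :=
  pi1_map (R := R) (bundle_proj_cont) (bundle_proj_north x).

End based_maps.

Arguments fiber_north {R p rho} p_ge2 rho_small w.
Arguments complement_north {R p rho} p_ge2 rho_small {S} u x.
Arguments fiber_rot_pi1 {R p rho} p_ge2 rho_small w.
Arguments fiber_incl_pi1 {R p rho} p_ge2 rho_small {S} u x.
Arguments bundle_proj_pi1 {R p rho} p_ge2 rho_small {S} u x.

(* Main.v *)
(* Over a homotopy H : I x I -> Sigma the angle of u o H admits a continuous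
   lift alpha relative to the side s = 0, and rotating the sphere through
   alpha / p carries the disks over H (0, t) to the disks over H (s, t).  Thus
   M restricted to the square is trivialized by rotations, all of which fix the
   north pole.  Lifting null-homotopies gives exactness in the middle, undoing
   the rotation gives injectivity of pi_1 (P_p) (so pi_2 (Sigma) plays no role),
   and the north pole is the section.  Transport along a loop on which u has
   winding number n is rotation through 2 pi n / p. *)

Require Import Defs.
From HB Require Import structures.
From mathcomp Require Import all_boot all_order all_algebra.
From mathcomp Require Import all_classical all_reals all_analysis.
From mathcomp Require Import homotopy complex.
From mathcomp Require Import ring lra.

Set Implicit Arguments.
Unset Strict Implicit.
Unset Printing Implicit Defensive.

Import Order.TTheory GRing.Theory Num.Theory.
Import numFieldNormedType.Exports.

Local Open Scope classical_set_scope.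
Local Open Scope ring_scope.

(** * Lifting the angle of a unit vector field over a square, relative to one side *)

Lemma unit_interval_compact (R : realType) : compact [set: unit_interval R].
Proof.
have -> : [set: unit_interval R] = @clamp R @` `[0, 1].
  by apply/seteqP; split=> // t _; exists (set_val t);
    [exact: itv_bounds|exact: clampK].
apply: continuous_compact (@segment_compact R 0 1).
exact/continuous_subspaceT/clamp_continuous.
Qed.

Section relative_lift.
Variable R : realType.
Notation I := (unit_interval R).

Lemma expiD (s t : R) : expi (s + t) = expi s * expi t.
Proof.
by rewrite /expi cosD sinD; apply/eqP; rewrite eq_complex /= [sin s * _ + _]addrC !eqxx.
Qed.

Lemma expi0 : expi 0 = 1 :> R[i].
Proof. by rewrite /expi cos0 sin0. Qed.

Lemma expiN (t : R) : expi (- t) * expi t = 1.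
Proof. by rewrite -expiD addNr expi0. Qed.

Lemma cont_cos (T : topologicalType) (f : T -> R) :
  continuous f -> continuous (fun x => cos (f x)).
Proof. exact/cont_comp/continuous_cos. Qed.

Lemma cont_sin (T : topologicalType) (f : T -> R) :
  continuous f -> continuous (fun x => sin (f x)).
Proof. exact/cont_comp/continuous_sin. Qed.

Lemma cont_sum (T : topologicalType) (n : nat) (f : nat -> T -> R) :
  (forall i, continuous (f i)) -> continuous (fun x => \sum_(i < n) f i x).
Proof.
move=> fc; elim: n => [|n IHn].
  by under eq_fun do rewrite big_ord0; exact: cont_cst.
under eq_fun do rewrite big_ord_recr /=.
exact: cont_add.
Qed.

Section lift.
Variables a b : I * I -> R.
Hypotheses (ac : continuous a) (bc : continuous b).
Hypothesis ab1 : forall z, a z ^+ 2 + b z ^+ 2 = 1.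

(** The segment from the side s = 0 to z is cut into n + 1 equal steps: j = 0 gives a point of that
    side and j = n + 1 gives z. The clamp makes sense of every natural j. *)
Definition subdivision (n j : nat) (z : I * I) : I * I :=
  (clamp (j%:R / n.+1%:R * set_val z.1), z.2).

(** The scalar product of the unit vectors at z and at its shift by h is 1 for h = 0. By compactness
    of the square it stays positive for all small h, uniformly in z. *)
Lemma small_step_acute : exists n : nat, forall k (z : I * I),
  0 < a (subdivision n k z) * a (subdivision n k.+1 z) +
      b (subdivision n k z) * b (subdivision n k.+1 z).
Proof.
pose shift (h : R) (z : I * I) : I * I := (clamp (set_val z.1 + h), z.2).
have shiftc : continuous (fun y : (I * I) * R => shift y.2 y.1).
  rewrite /shift; cont_tac.
have : compact [set: I * I].
  rewrite -setXTT; exact: compact_setX (@unit_interval_compact R) (@unit_interval_compact R).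
move=> /compact_near_coveringP/(_ R (nbhs (0 : R))
  (fun h z => 0 < a z * a (shift h z) + b z * b (shift h z)) _).
case=> [z _|e /= e0 he].
  have Gc : continuous (fun y : (I * I) * R =>
      a y.1 * a (shift y.2 y.1) + b y.1 * b (shift y.2 y.1)).
    apply: cont_add; apply: cont_mul; first
      [exact: cont_comp shiftc | apply: cont_comp => //; cont_tac].
  have s0 : shift 0 z = z by case: z => s t; rewrite /shift /= addr0 clampK.
  have := @Gc (z, 0) [set x | 0 < x]; apply.
  rewrite /= s0 -!expr2 ab1; apply: open_nbhs_nbhs; split; last exact: ltr01.
  exact: open_gt.
have [n ne] : exists n : nat, n.+1%:R^-1 < e.
  exists (Num.truncn e^-1).
  by rewrite invf_plt ?posrE ?ltr0n//; exact: truncnS_gt.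
exists n => k z; pose w j := subdivision n j z.
set h := set_val z.1 / n.+1%:R.
have /andP[z0 z1] := itv_bounds z.1.
have n0 : (0 : R) < n.+1%:R by rewrite ltr0n.
have h0 : 0 <= h by rewrite divr_ge0// ltW.
have hn : h <= n.+1%:R^-1 by rewrite ler_pdivrMr// mulVf// gt_eqF.
have clamp_min (t : R) : 0 <= t -> set_val (clamp t) = Num.min 1 t.
  by move=> t0; apply/max_idPr; rewrite le_min ler01.
have wE j : w j = (clamp (j%:R * h), z.2).
  by rewrite /w /subdivision /h mulrAC mulrA.
(* Clamping after each step agrees with clamping once, since all steps go to the right. *)
have wS : w k.+1 = shift h (w k).
  have kh0 : 0 <= k%:R * h by rewrite mulr_ge0.
  rewrite !wE /shift; congr (_, _); apply: val_inj; rewrite -!set_valE /=.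
  rewrite (clamp_min (k%:R * h))// !clamp_min; last 2 first.
  - by rewrite addr_ge0// le_min ler01.
  - by rewrite mulr_ge0.
  rewrite -natr1 mulrDl mul1r.
  case: (leP 1 (k%:R * h)) => // kh1.
  by rewrite !(min_idPl _)// ?lerDl// (le_trans kh1)// lerDl.
rewrite -/(w _) -/(w _) wS; apply: he => //=.
by rewrite sub0r normrN ger0_norm// (le_lt_trans hn).
Qed.

(* The increments of the angle between consecutive points of a fine enough
   subdivision are acute, so each is the arcsine of a continuous function. *)
Lemma relative_lift : exists alpha : I * I -> R,
  [/\ continuous alpha, forall t, alpha (itv0 R, t) = 0 &
      forall s t, (a (s, t) +i* b (s, t))%C =
        expi (alpha (s, t)) * (a (itv0 R, t) +i* b (itv0 R, t))%C].
Proof.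
have [n acute] := small_step_acute.
pose w := subdivision n.
(* [c] and [d] are the cosine and sine of the angle from the vector at [w j z] to the one at
   [w j.+1 z]. *)
pose c j z := a (w j z) * a (w j.+1 z) + b (w j z) * b (w j.+1 z).
pose d j z := a (w j z) * b (w j.+1 z) - b (w j z) * a (w j.+1 z).
have c_gt0 j z : 0 < c j z by exact: acute.
have cd j z : c j z ^+ 2 + d j z ^+ 2 = 1.
  transitivity ((a (w j z) ^+ 2 + b (w j z) ^+ 2) *
                (a (w j.+1 z) ^+ 2 + b (w j.+1 z) ^+ 2)); first by rewrite /c /d; ring.
  by rewrite !ab1 mulr1.
(* The strict bounds come from [c_gt0]; [asin] is continuous on the open interval. *)
have d_lt1 j z : -1 < d j z < 1.
  by have := c_gt0 j z; have := cd j z; move: (c _ _) (d _ _) => x y; nra.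
have d_le1 j z : -1 <= d j z <= 1 by have /andP[? ?] := d_lt1 j z; rewrite !ltW.
have expi_asin j z : expi (asin (d j z)) = (c j z +i* d j z)%C.
  rewrite /expi cos_asin// asinK ?in_itv//=; congr (_ +i* _)%C.
  by rewrite -(cd j z) addrK sqrtr_sqr gtr0_norm.
have wc j : continuous (w j) by rewrite /w /subdivision; cont_tac.
have dc j : continuous (d j).
  rewrite /d; apply: cont_add; last apply: cont_opp;
  by apply: cont_mul; apply: cont_comp.
have turn j z : (a (w j.+1 z) +i* b (w j.+1 z))%C =
    expi (asin (d j z)) * (a (w j z) +i* b (w j z))%C.
  rewrite expi_asin; apply/eqP; rewrite eq_complex /=; apply/andP; split; apply/eqP.
    transitivity ((a (w j z) ^+ 2 + b (w j z) ^+ 2) * a (w j.+1 z)).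
      by rewrite ab1 mul1r.
    by rewrite /c /d; ring.
  transitivity ((a (w j z) ^+ 2 + b (w j z) ^+ 2) * b (w j.+1 z)).
    by rewrite ab1 mul1r.
  by rewrite /c /d; ring.
exists (fun z => \sum_(j < n.+1) asin (d j z)); split.
- apply: (@cont_sum _ _ (fun j z => asin (d j z))) => j z.
  by apply: continuous_comp; [exact: dc|exact: continuous_asin].
- move=> t; apply: big1 => j _.
  rewrite /d /w /subdivision /= clampE ?lexx ?ler01// !mulr0 [X in asin X](_ : _ = 0).
    by rewrite -[X in asin X](sin0 R) sinK// in_itv /= oppr_le0 andbb divr_ge0// pi_ge0.
  by ring.
- move=> s t.
  have turns m : (a (w m (s, t)) +i* b (w m (s, t)))%C =
      expi (\sum_(j < m) asin (d j (s, t))) * (a (itv0 R, t) +i* b (itv0 R, t))%C.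
    elim: m => [|m IHm].
      by rewrite big_ord0 expi0 mul1r /w /subdivision /= !mul0r.
    by rewrite turn IHm big_ord_recr /= mulrA -expiD addrC.
  have := turns n.+1; rewrite /w /subdivision /= mulfV ?pnatr_eq0// mul1r clampK.
  by [].
Qed.

End lift.
End relative_lift.

(** * Circle-valued maps: lifts, winding numbers, continuity *)

Section circle_maps.
Variable R : realType.
Notation I := (unit_interval R).

Lemma expi_onto (z : R[i]) : `|z| = 1 -> exists t, expi t = z.
Proof.
case: z => x y; rewrite normc_def => /complexI /(congr1 (fun r => r ^+ 2)).
rewrite /= sqr_sqrtr ?addr_ge0 ?sqr_ge0// expr1n => xy1.
have x1 : -1 <= x <= 1 by nra.
have yE : Num.sqrt (1 - x ^+ 2) = `|y| by rewrite -xy1 addrC addKr sqrtr_sqr.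
case: (leP 0 y) => y0.
  by exists (acos x); rewrite /expi acosK// sin_acos// yE ger0_norm.
exists (- acos x).
by rewrite /expi cosN sinN acosK// sin_acos// yE ltr0_norm// opprK.
Qed.

(** By the double angle formula sin (pi d) = 0, hence also sin (pi f) = 0 for the fractional part f
    of d. As 0 <= f < 1 and the sine is positive between 0 and pi, f = 0. *)
Lemma expi_eq1_int (d : R) : expi (2 * pi * d) = 1 -> exists n : int, d = n%:~R.
Proof.
move=> /eqP; rewrite eq_complex /= => /andP[/eqP cd1 _].
exists (Num.floor d); have /andP[d0 d1] := floor_itv d.
move: (Num.floor d) d0 d1 => n d0 d1.
have sind : sin (pi * d) = 0.
  apply/eqP; rewrite -sqrf_eq0 sin2cos2 subr_eq0 eq_sym; apply/eqP.
  have := cos_mulr2n (pi * d); rewrite -mulrnAl -[pi *+ 2]mulr_natl cd1; lra.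
have sin_nat (k : nat) : sin (pi * k%:R) = 0 :> R.
  elim: k => [|k IHk]; first by rewrite mulr0 sin0.
  by rewrite -natr1 mulrDr mulr1 sinDpi IHk oppr0.
have sin_int : sin (pi * n%:~R) = 0 :> R.
  case: (n) => k; first exact: sin_nat.
  by rewrite NegzE mulrNz mulrN sinN -pmulrn sin_nat oppr0.
have fr0 : sin (pi * (d - n%:~R)) = 0.
  by rewrite mulrBr sinB sind sin_int mul0r mulr0 subrr.
apply/eqP; rewrite -subr_eq0 eq_le subr_ge0 d0 andbT leNgt; apply/negP => dn.
have : 0 < sin (pi * (d - n%:~R)).
  apply: sin_gt0_pi; rewrite mulr_gt0 ?pi_gt0//=.
  by rewrite gtr_pMr ?pi_gt0// ltrBlDr addrC -intrD1.
by rewrite fr0 ltxx.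
Qed.

Section circle_map.
Variables (S : topologicalType) (u : S -> R[i]).
Hypotheses (uRe : continuous (fun x => complex.Re (u x)))
  (uIm : continuous (fun x => complex.Im (u x))) (u1 : forall x, `|u x| = 1).

(** The normalization on the side s = 0 makes the rotations built from [alpha] start at the
    identity. *)
Lemma circle_map_lift (H : I * I -> S) : continuous H ->
  exists alpha : I * I -> R,
    [/\ continuous alpha, forall t, alpha (itv0 R, t) = 0 &
        forall s t, u (H (s, t)) = expi (alpha (s, t)) * u (H (itv0 R, t))].
Proof.
move=> Hc.
have [|||alpha [alphac alpha0 alphaE]] := @relative_lift R
    (fun z => complex.Re (u (H z))) (fun z => complex.Im (u (H z))).
- exact: cont_comp uRe Hc.
- exact: cont_comp uIm Hc.
- move=> z; have := u1 (H z); rewrite normc_def => /complexI.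
  move=> /(congr1 (fun r => r ^+ 2)).
  by rewrite sqr_sqrtr ?addr_ge0 ?sqr_ge0// expr1n.
- exists alpha; split=> // s t; move: (alphaE s t).
  by case: (u (H (s, t))) => ? ?; case: (u (H (itv0 R, t))).
Qed.

Lemma winding_number_exists (x : S) (l : loop R x) :
  exists n, winding_number u l n.
Proof.
(* The loop runs in the direction of the lift; the second coordinate is a dummy. *)
have [|alpha [alphac alpha0 alphaE]] := @circle_map_lift (fun z => l z.1).
  by apply: (cont_comp (@loop_cont _ _ _ l)); cont_tac.
have [t0 t0E] := expi_onto (u1 x).
have l0 : l (itv0 R) = x by exact: path_zero.
have l1 : l (itv1 R) = x by exact: path_one.
have pi2 : 2 * pi != 0 :> R by rewrite mulf_neq0 ?pnatr_eq0// gt_eqF// pi_gt0.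
(* Adding an angle [t0] of [u x] makes the relative lift absolute; winding numbers count full turns,
   whence the division. *)
pose theta t := (alpha (t, itv0 R) + t0) / (2 * pi).
have uE t : u (l t) = expi (2 * pi * theta t).
  by rewrite /theta mulrC divfK// expiD t0E -[in RHS]l0 -(alphaE t (itv0 R)).
have [n nE] : exists n : int, theta (itv1 R) - theta (itv0 R) = n%:~R.
  apply: expi_eq1_int; rewrite mulrBr expiD -uE l1 -{1}l0 uE -expiD subrr.
  exact: expi0.
exists n, theta; split=> //; rewrite /theta.
cont_tac; apply: (cont_comp alphac); cont_tac.
Qed.

(** Every loop has a winding number, so the [xget] in [circle_map_pi1] selects an attained value
    rather than its default 0. *)
Lemma circle_map_pi1_winding (x : S) (c : pi1 R x) :
  exists2 l : loop R x, pi1_class l = c & winding_number u l (circle_map_pi1 u c).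
Proof.
apply: (@xgetPex _ 0 [set n | exists2 l : loop R x, pi1_class l = c & winding_number u l n]).
have [l ->] := pi1_ind c; have [n ln] := winding_number_exists l.
by exists n, l.
Qed.

End circle_map.

(** Order 0 of smoothness is continuity in a chart; near x the function equals its chart expression
    composed with the chart map. *)
Lemma smooth_circle_map_continuous (S : topologicalType) (A : set (chart R S))
    (u : S -> R[i]) : oriented_smooth_atlas A -> smooth_circle_map A u ->
  continuous (fun x => complex.Re (u x)) /\ continuous (fun x => complex.Im (u x)).
Proof.
move=> [Achart Acover _] [_ uRe uIm].
suff smooth_cont (f : S -> R) : smooth_function A f -> continuous f by split; exact: smooth_cont.
move=> fs x; have [c Ac cx] := Acover x.
have [c_open _ cK mapc _] := Achart _ Ac.
have cod_x : chart_cod c (chart_map c x) by exists x.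
have [/= fc _] := fs c Ac 0%N.
have cx_at : {for x, continuous (chart_map c)}.
  by move: mapc; rewrite continuous_open_subspace// => /(_ x); apply; exact/mem_set.
have fx := continuous_comp cx_at (fc _ cod_x).
rewrite /continuous_at -[X in _ --> X](_ : (f \o chart_inv c) (chart_map c x) = f x); last first.
  by rewrite /= cK//; exact/mem_set.
apply: cvg_trans fx; apply: near_eq_cvg.
have : \forall y \near x, chart_dom c y by exact: open_nbhs_nbhs.
by apply: filterS => y cy; rewrite /= cK//; exact/mem_set.
Qed.

End circle_maps.

(** * Homotopies read off a square, and split extensions of groups *)

Lemma square_homotopic (R : realType) (X : topologicalType) (x : X)
    (F : unit_interval R * unit_interval R -> X) (left right bottom top : loop R x) :
  continuous F ->
  (forall t, left t = F (itv0 R, t)) -> (forall t, right t = F (itv1 R, t)) ->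
  (forall s, bottom s = F (s, itv0 R)) -> (forall s, top s = F (s, itv1 R)) ->
  homotopic (loop_cat left top) (loop_cat bottom right).
Proof.
move=> Fc leftE rightE bottomE topE.
have F00 : F (itv0 R, itv0 R) = x by rewrite -leftE; exact: path_zero.
have F11 : F (itv1 R, itv1 R) = x by rewrite -rightE; exact: path_one.
(* Left then top is t |-> (clamp (2t - 1), clamp (2t)), and bottom then right is the same with
   coordinates swapped. [mix] interpolates linearly before clamping, so the end points stay at the
   corners (0, 0) and (1, 1). *)
pose mix (z : unit_interval R * unit_interval R) (a b : R) :=
  (1 - set_val z.1) * a + set_val z.1 * b.
exists (fun z => F
  (clamp (mix z (2 * set_val z.2 - 1) (2 * set_val z.2)),
   clamp (mix z (2 * set_val z.2) (2 * set_val z.2 - 1)))).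
split=> /=.
- by apply: (cont_comp Fc); rewrite /mix; cont_tac.
- move=> t; rewrite /mix /= clampE ?lexx ?ler01// subr0 !mul1r !mul0r !addr0.
  rewrite loop_catE; case: leP => th.
    by rewrite leftE clamp_le0//; lra.
  by rewrite topE [clamp (2 * _)]clamp_ge1//; lra.
- move=> t; rewrite /mix /= clampE ?lexx ?ler01// subrr !mul1r !mul0r !add0r.
  rewrite loop_catE; case: leP => th.
    by rewrite bottomE [clamp (_ - 1)]clamp_le0//; lra.
  by rewrite rightE [clamp (2 * _)]clamp_ge1//; lra.
- move=> s; have s01 := itv_bounds s; rewrite /mix /= !clampE ?lexx ?ler01//.
  by split; [rewrite !clamp_le0//|rewrite !clamp_ge1//]; lra.
Qed.

(* In MathComp [{multiplicative _ -> _}] only carries [gmulfM]; between groups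
   the unit and the inverses are preserved automatically. *)
Section group_morphisms.
Variables (G H : groupType) (f : {multiplicative G -> H}).

Lemma multiplicative1 : f 1%g = 1%g.
Proof. by apply: (@mulgI _ (f 1%g)); rewrite -gmulfM !mulg1. Qed.

Lemma multiplicativeV x : f x^-1%g = (f x)^-1%g.
Proof.
by apply: (@mulgI _ (f x)); rewrite -gmulfM !mulgV multiplicative1.
Qed.

Lemma multiplicative_inj : (forall x, f x = 1%g -> x = 1%g) -> injective f.
Proof.
move=> ker1 x y fxy; apply: (@mulIg _ y^-1%g); rewrite mulgV.
by apply: ker1; rewrite gmulfM multiplicativeV fxy mulgV.
Qed.

End group_morphisms.

(** The action is conjugation by [s h], read back through [i]. It is characterized by a commutation
    relation because that is what a homotopy over a square provides. *)
Lemma split_exact_sdprod (N G H : groupType) (i : {multiplicative N -> G})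
    (q : {multiplicative G -> H}) (s : {multiplicative H -> G}) :
  short_exact i q -> cancel s q ->
  exists phi : group_action N H,
    (forall n h m, (i n * s h)%g = (s h * i m)%g -> phi n h = m) /\
    exists Phi : {multiplicative sdprod phi -> G},
      [/\ bijective Phi, forall n, Phi (sd_inl phi n) = i n
        & forall h, Phi (sd_inr phi h) = s h].
Proof.
move=> [i_inj kerq q_onto] sK.
have qi n : q (i n) = 1%g by apply/kerq; exists n.
have conj n h : exists m, i m = ((s h)^-1 * i n * s h)%g.
  by apply/kerq; rewrite !gmulfM qi mulg1 multiplicativeV mulVg.
pose act n h := projT1 (cid (conj n h)).
have actE n h : i (act n h) = ((s h)^-1 * i n * s h)%g by rewrite /act; case: cid.
have act1 n : act n 1%g = n by apply: i_inj; rewrite actE multiplicative1 invg1 mul1g mulg1.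
have actM n h1 h2 : act n (h1 * h2)%g = act (act n h1) h2.
  by apply: i_inj; rewrite !actE gmulfM invgM !mulgA.
have act_mul h n1 n2 : act (n1 * n2)%g h = (act n1 h * act n2 h)%g.
  by apply: i_inj; rewrite gmulfM !actE gmulfM !mulgA mulgK.
pose phi := GroupAction act1 actM act_mul.
exists phi; split=> [n h m nm|].
  by apply: i_inj; rewrite [LHS]actE -mulgA nm mulKg.
(* Base before fiber, as required by the right action. *)
pose f (y : sdprod phi) := (s (sd_base y) * i (sd_fiber y))%g.
have fM : {morph f : y z / (y * z)%g}.
  move=> y z; rewrite /f /= !gmulfM [i (phi _ _)]actE !mulgA; congr (_ * _)%g.
  by rewrite mulgK.
pose Phi : {multiplicative sdprod phi -> G} :=
  HB.pack f (isMultiplicative.Build _ _ f fM).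
exists Phi; split=> [|n|h]; last 2 first.
- by rewrite /= /f /= multiplicative1 mul1g.
- by rewrite /= /f /= multiplicative1 mulg1.
have fib y : exists n, i n = ((s (q y))^-1 * y)%g.
  by apply/kerq; rewrite gmulfM multiplicativeV sK mulVg.
(* The inverse splits y as s (q y) times an element of the kernel of [q]. *)
exists (fun y => Sdprod phi (q y) (projT1 (cid (fib y)))) => [[h n]|y] /=.
- have qf : q (f (Sdprod phi h n)) = h by rewrite /f /= gmulfM sK qi mulg1.
  case: cid => m /= im; rewrite qf; congr Sdprod; apply: i_inj.
  by rewrite im qf /f /= mulKg.
- by case: cid => m /= im; rewrite /f /= im mulVKg.
Qed.

(** * Rotations of the sphere carrying one fiber to another *)

Section sphere_rotation.
Variable R : realType.

Lemma sphere_rot0 (v : sphere2 R) : sphere_rot 0 v = v.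
Proof.
apply: val_inj; case: v => -[[x y] z] vP.
by rewrite /= /rot_vec cos0 sin0 !mul1r !mul0r subr0 add0r.
Qed.

Lemma sphere_rot_north (t : R) : sphere_rot t (north (R := R)) = north.
Proof. by apply: val_inj => /=; rewrite /rot_vec /= !mulr0 subr0 addr0. Qed.

Lemma cont_sphere_rot (T : topologicalType) (t : T -> R) (v : T -> sphere2 R) :
  continuous t -> continuous v -> continuous (fun z => sphere_rot (t z) (v z)).
Proof.
move=> tc vc; apply: sig_cont => /=; rewrite /rot_vec.
have wc : continuous (fun z => set_val (v z)).
  exact: cont_comp (@sig_val_cont _ (sphere2 R)) vc.
have xc := cont_fst (cont_fst wc); have yc := cont_snd (cont_fst wc).
have zc := cont_snd wc; have cc := cont_cos tc; have sc := cont_sin tc.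
by apply: cont_pair => //; apply: cont_pair;
  apply: cont_add; [|apply: cont_opp| |]; apply: cont_mul.
Qed.

Variables (p : nat) (rho : R).
Hypothesis p_ge2 : (2 <= p)%N.

Lemma equatorial_roots_rot (t : R) (w : R[i]) (c : sphere2 R) :
  equatorial_roots p w c ->
  equatorial_roots p (expi t * w) (sphere_rot (t / p%:R) c).
Proof.
move=> [z [z1 zw cz]]; exists (expi (t / p%:R) * z); split.
- by rewrite normrM norm_expi mul1r.
- rewrite exprMn zw expiX -[_ / _ *+ _]mulr_natr divfK//.
  by rewrite pnatr_eq0 -lt0n (leq_trans _ p_ge2).
- by rewrite sphere_rotE cz rot_equator.
Qed.

(** Rotating back takes a disk center over [expi t * w] to one over [w], and rotations preserve
    scalar products, hence the disks. *)
Lemma planar_fiber_rot (t : R) (w : R[i]) (v : sphere2 R) :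
  planar_fiber p rho w v ->
  planar_fiber p rho (expi t * w) (sphere_rot (t / p%:R) v).
Proof.
move=> Fv [c cw hc]; apply: Fv; exists (sphere_rot (- t / p%:R) c).
  by have := equatorial_roots_rot (- t) cw; rewrite mulrA expiN mul1r.
rewrite sphere_rotE -(rotNK (t / p%:R) (set_val v)) mulNr dot3_rot.
by rewrite -sphere_rotE.
Qed.

End sphere_rotation.

(** * Exactness, the section at the north pole, and transport along loops *)

Section complement_homotopy.
Variables (R : realType) (p : nat) (rho : R).
Hypotheses (p_ge2 : (2 <= p)%N) (rho_small : small_radius p rho).
Variables (S : topologicalType) (u : S -> R[i]).
Hypotheses (uRe : continuous (fun x => complex.Re (u x)))
  (uIm : continuous (fun x => complex.Im (u x))) (u1 : forall x, `|u x| = 1).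
Variable x0 : S.

Notation I := (unit_interval R).
Notation M := (multisection_complement p rho u).
Notation P := (planar_fiber p rho (u x0)).
Notation incl := (fiber_incl_pi1 p_ge2 rho_small u x0).
Notation proj := (bundle_proj_pi1 p_ge2 rho_small u x0).

Lemma complementP (y : M) : planar_fiber p rho (u (set_val y).1) (set_val y).2.
Proof. exact: (set_mem (valP y)). Qed.

Lemma complement_subproof (x : S) (v : sphere2 R) :
  planar_fiber p rho (u x) v -> (x, v) \in M.
Proof. by move=> h; rewrite inE. Qed.

Lemma bundle_proj_fiber_incl n : proj (incl n) = 1%g.
Proof.
have [l ->] := pi1_ind n; rewrite [incl _]pi1_map_class [LHS]pi1_map_class.
exact/pi1_classP/homotopic_eq.
Qed.

(* Rotating the sphere over [H (s, t)] through the angle by which [u] has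
   turned along [s] lifts the null-homotopy of the projected loop to the
   complement; its end lies in the fiber over [x0]. *)
Lemma fiber_incl_onto_kernel c : proj c = 1%g -> exists n, incl n = c.
Proof.
have [l ->] := pi1_ind c; rewrite [LHS]pi1_map_class => /pi1_classP[H [Hc H0 H1 Hx]].
have [alpha [alphac alpha0 alphaE]] := circle_map_lift uRe uIm u1 Hc.
pose y t := set_val (l t).
have yc : continuous y by exact: cont_comp (@sig_val_cont _ M) (@loop_cont _ _ _ l).
have H0E t : H (itv0 R, t) = (y t).1 by rewrite H0 loop_mapE.
have l0 : l (itv0 R) = complement_north p_ge2 rho_small u x0 by exact: path_zero.
have l1 : l (itv1 R) = complement_north p_ge2 rho_small u x0 by exact: path_one.
pose v z := sphere_rot (alpha z / p%:R) (y z.2).2.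
have vc : continuous v.
  apply: cont_sphere_rot; first by cont_tac.
  by apply: cont_snd; apply: (cont_comp yc); cont_tac.
have vM s t : planar_fiber p rho (u (H (s, t))) (v (s, t)).
  by rewrite alphaE H0E; apply: planar_fiber_rot => //; exact: complementP.
(* The pole is fixed by all rotations, so the lifted homotopy is constant in the sphere on the ends
   t = 0 and t = 1. *)
have v0 s : v (s, itv0 R) = north by rewrite /v /y /= l0 /= sphere_rot_north.
have v1 s : v (s, itv1 R) = north by rewrite /v /y /= l1 /= sphere_rot_north.
have vP t : v (itv1 R, t) \in P by rewrite inE; have := vM (itv1 R) t; rewrite H1.
pose m t : P := SigSub (vP t).
have mc : continuous m.
  apply: sig_cont; apply: (@cont_comp _ _ _ (fun t => (itv1 R, t)) v) => //.
  by cont_tac.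
have m0 : m zero = fiber_north p_ge2 rho_small (u x0).
  by apply: val_inj; rewrite /= v0.
have m1 : m one = fiber_north p_ge2 rho_small (u x0).
  by apply: val_inj; rewrite /= v1.
exists (pi1_class (mk_path mc m0 m1)); rewrite [LHS]pi1_map_class.
apply/esym/pi1_classP.
have HvM z : (H z, v z) \in M by case: z => s t; exact: complement_subproof.
exists (fun z => SigSub (HvM z) : M); split.
- by apply: sig_cont; apply: cont_pair.
- move=> t; apply: val_inj; rewrite /= H0E /v alpha0 mul0r sphere_rot0.
  by rewrite /y -set_valE -surjective_pairing.
- by move=> t; apply: val_inj; rewrite /= H1.
- by move=> s; split; apply: val_inj; rewrite /= ?(Hx s).1 ?(Hx s).2 ?v0 ?v1.
Qed.

(* A null-homotopy in the complement is pushed back to the fiber over [x0] by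
   undoing, at each point, the turning of [u]. *)
Lemma fiber_incl_injective : injective incl.
Proof.
apply: multiplicative_inj => c; have [l ->] := pi1_ind c.
rewrite [LHS]pi1_map_class => /pi1_classP[H [Hc H0 H1 Hx]].
have Hvc : continuous (fun z => set_val (H z)).
  exact: cont_comp (@sig_val_cont _ M) Hc.
have [alpha [alphac alpha0 alphaE]] := circle_map_lift uRe uIm u1 (cont_fst Hvc).
pose v z := sphere_rot (- alpha z / p%:R) (set_val (H z)).2.
have vc : continuous v.
  by apply: cont_sphere_rot; [cont_tac|exact: cont_snd].
have vP z : v z \in P.
  rewrite inE; case: z => s t.
  (* The side s = 0 is the included loop, which lies over [x0]. *)
  have -> : u x0 = expi (- alpha (s, t)) * u (set_val (H (s, t))).1.
    by rewrite alphaE mulrA expiN mul1r H0.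
  by apply: planar_fiber_rot => //; exact: complementP.
apply/pi1_classP; exists (fun z => SigSub (vP z) : P); split.
- exact: sig_cont.
- move=> t; apply: val_inj.
  by rewrite /= /v alpha0 oppr0 mul0r sphere_rot0 H0.
- by move=> t; apply: val_inj; rewrite /= /v H1 sphere_rot_north.
- move=> s; split; apply: val_inj;
  by rewrite /= /v ?(Hx s).1 ?(Hx s).2 sphere_rot_north.
Qed.

Lemma complement_north_cont : continuous (complement_north p_ge2 rho_small u).
Proof. by apply: sig_cont; apply: cont_pair; cont_tac. Qed.

Definition north_section_pi1 :
    pi1 R x0 -> pi1 R (complement_north p_ge2 rho_small u x0) :=
  pi1_map complement_north_cont erefl.

Lemma north_section_pi1K : cancel north_section_pi1 proj.
Proof.
move=> c; have [l ->] := pi1_ind c.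
rewrite /north_section_pi1 pi1_map_class [LHS]pi1_map_class.
exact/pi1_classP/homotopic_eq.
Qed.

(* Homotopy over the square [(s, t) |-> (h s, rotation of l t)]. *)
Lemma north_section_conj (h : loop R x0) (n : int)
    (l l' : loop R (fiber_north p_ge2 rho_small (u x0))) :
  winding_number u h n ->
  (forall t, set_val (l' t) =
     sphere_rot (2 * pi * n%:~R / p%:R) (set_val (l t))) ->
  (incl (pi1_class l) * north_section_pi1 (pi1_class h) =
   north_section_pi1 (pi1_class h) * incl (pi1_class l'))%g.
Proof.
move=> [theta [thetac uE thetan]] l'E.
have l0 : l (itv0 R) = fiber_north p_ge2 rho_small (u x0) by exact: path_zero.
have l1 : l (itv1 R) = fiber_north p_ge2 rho_small (u x0) by exact: path_one.
have h0 : h (itv0 R) = x0 by exact: path_zero.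
have h1 : h (itv1 R) = x0 by exact: path_one.
(* The turning of [u] since the start of [h]: 0 at s = 0, so the left side of the square is [l], and
   2 pi n at s = 1, so the right side is [l']. *)
pose alpha s := 2 * pi * (theta s - theta (itv0 R)).
have uhE s : u (h s) = expi (alpha s) * u x0.
  by rewrite uE -[in RHS]h0 uE -expiD /alpha; congr expi; ring.
pose v (z : I * I) := sphere_rot (alpha z.1 / p%:R) (set_val (l z.2)).
have vM z : (h z.1, v z) \in M.
  apply: complement_subproof; rewrite uhE; apply: planar_fiber_rot => //.
  exact: (set_mem (valP (l z.2))).
have alphac : continuous alpha by rewrite /alpha; cont_tac.
rewrite [incl _]pi1_map_class [incl _]pi1_map_class /north_section_pi1 pi1_map_class.
rewrite !pi1_mulE !pi1_mul_class; apply/pi1_classP.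
apply: (@square_homotopic _ _ _ (fun z => SigSub (vM z) : M)).
- apply: sig_cont; apply: cont_pair.
    by apply: (cont_comp (@loop_cont _ _ _ h)); cont_tac.
  apply: cont_sphere_rot.
    by cont_tac; apply: (cont_comp alphac); cont_tac.
  apply: (cont_comp (@sig_val_cont _ P)).
  by apply: (cont_comp (@loop_cont _ _ _ l)); cont_tac.
- move=> t; apply: val_inj.
  by rewrite /= /v /= /alpha subrr mulr0 mul0r sphere_rot0 h0.
- by move=> t; apply: val_inj; rewrite /= l'E /v /= /alpha thetan h1.
- by move=> s; apply: val_inj; rewrite /= /v /= l0 sphere_rot_north.
- by move=> s; apply: val_inj; rewrite /= /v /= l1 sphere_rot_north.
Qed.

End complement_homotopy.

(** * The semidirect product and the action of the standard generators *)

Theorem proposition5p1 (R : realType) (g p : nat)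
  (g_ge1 : (1 <= g)%N) (p_ge2 : (2 <= p)%N)
  (Sigma : topologicalType) (atlas : set (chart R Sigma))
  (Sigma_surface : closed_connected_oriented_surface atlas)
  (Sigma_genus : has_genus R Sigma g)
  (u : Sigma -> R[i]) (u_smooth : smooth_circle_map atlas u)
  (x0 : Sigma) (u_primitive : primitive_class (@circle_map_pi1 R Sigma x0 u))
  (a b : 'I_g -> pi1 R x0) (ab_standard : surface_presentation a b)
  (u_a : forall i : 'I_g, circle_map_pi1 u (a i) = if i == 0%N :> nat then 1 else 0)
  (u_b : forall i : 'I_g, circle_map_pi1 u (b i) = 0)
  (rho : R) (rho_small : small_radius p rho) :
  let incl := fiber_incl_pi1 p_ge2 rho_small u x0 in
  let proj := bundle_proj_pi1 p_ge2 rho_small u x0 in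
  let r_star := fiber_rot_pi1 p_ge2 rho_small (u x0) in
  short_exact incl proj /\
  exists s : {multiplicative pi1 R x0 ->
                pi1 R (complement_north p_ge2 rho_small u x0)},
    cancel s proj /\
    exists phi : group_action (pi1 R (fiber_north p_ge2 rho_small (u x0)))
                              (pi1 R x0),
      [/\ forall (i : 'I_g) n, phi n (a i) = if i == 0%N :> nat then r_star n else n,
          forall (i : 'I_g) n, phi n (b i) = n
        & exists Phi : {multiplicative sdprod phi ->
                          pi1 R (complement_north p_ge2 rho_small u x0)},
            [/\ bijective Phi,
                forall n, Phi (sd_inl phi n) = incl n
              & forall h, Phi (sd_inr phi h) = s h]].
Proof.
move=> incl proj r_star.
have [u1 _ _] := u_smooth; have [_ _ _ atlasP] := Sigma_surface.
have [uRe uIm] := smooth_circle_map_continuous atlasP u_smooth.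
pose s : {multiplicative pi1 R x0 ->
    pi1 R (complement_north p_ge2 rho_small u x0)} :=
  pi1_map (@complement_north_cont R p rho p_ge2 rho_small Sigma u) (erefl _).
have sK : cancel s proj by exact: north_section_pi1K.
have incl_proj : short_exact incl proj.
  split; first exact: fiber_incl_injective.
    move=> y; split; first exact: fiber_incl_onto_kernel.
    by move=> [n <-]; exact: bundle_proj_fiber_incl.
  by move=> h; exists (s h).
split=> //; exists s; split=> //.
have [phi [phiE Phi]] := split_exact_sdprod incl_proj sK.
(* Winding number 0 means transport by the rotation through angle 0. *)
have act0 h n : circle_map_pi1 u h = 0 -> phi n h = n.
  move=> h0; apply: phiE; have [l lh] := circle_map_pi1_winding uRe uIm u1 h.
  rewrite h0 => hw; rewrite -lh; have [m ->] := pi1_ind n.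
  by apply: north_section_conj hw _ => t; rewrite mulr0 mul0r sphere_rot0.
exists phi; split=> // [i n|i n]; last exact: act0.
(* For the first generator the winding number is 1, and 2 pi / p is the angle of [fiber_rot]. *)
have := u_a i; case: eqP => _; last exact: act0.
move=> ai; apply: phiE; have [l lh] := circle_map_pi1_winding uRe uIm u1 (a i).
rewrite ai => hw; rewrite -lh; have [m ->] := pi1_ind n.
rewrite [r_star _]pi1_map_class.
by apply: north_section_conj hw _ => t; rewrite mulr1.
Qed.
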